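(* Let $n\ge3$ and let $X_{A,B,C}$ be a simple (undirected, loopless) quantum graph on $M_n$. Then $X_{A,B,C}$ is connected if and only if its strange graph $\mathfrak G(A,C)$ is connected.
   Context: $M_n=M_n(\mathbb C)$, with matrix units $E_{ij}$; ''projector'' means orthogonal projector; $\mathbf 1$ is the all-ones vector. For $A,B,C\in M_n$ with $\operatorname{diag}A=\operatorname{diag}B=\operatorname{diag}C$, $$X_{A,B,C}(x)=\sum_{i\ne j}A_{ij}\,x_{jj}E_{ii}+\sum_{i,j}B_{ij}\,x_{ij}E_{ij}+\sum_{i\neq j}C_{ij}\,x_{ji}E_{ij}.$$ A quantum graph on $M_n$ is a linear map $G\colon M_n\to M_n$ with $\sum_{k} G(E_{ik})G(E_{kj})=G(E_{ij})$ for all $i,j$ and $G(x^\dagger)=G(x)^\dagger$; it is undirected if self-adjoint for $\langle x,y\rangle=\mathrm{Tr}(x^\dagger y)$, and loopless if $\sum_k G(E_{ik})E_{kj}=0$ for all $i,j$. (Equivalently for $X_{A,B,C}$: $B$ is a real symmetric projector with $B\mathbf 1=0$, $A_{ij}=A_{ji}$ for $i\neq j$, and $X_{ij}:=\begin{pmatrix} A_{ij} & C_{ij} \\ C_{ji} & A_{ji} \end{pmatrix}$ is a projector for all $i\neq j$.) Each such $X_{ij}$ ($i<j$) is $0$, $I$, or $\frac12\begin{pmatrix} 1 & e^{\mathrm i\theta} \\ e^{-\mathrm i\theta} & 1 \end{pmatrix}$ with $\theta\in[0,2\pi)$. The strange graph $\mathfrak G(A,C)$ is the undirected graph on $\{1,\dots,n\}$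 with a classical edge $\{i,j\}$ when $X_{ij}=I$, a strange edge $\{i,j\}$ ($i<j$) of phase $\theta$ when $X_{ij}=\frac12\begin{pmatrix} 1 & e^{\mathrm i\theta} \\ e^{-\mathrm i\theta} & 1 \end{pmatrix}$, and no edge when $X_{ij}=0$; its connectedness is that of the ordinary graph with all (classical and strange) edges. A quantum graph $G$ is disconnected if there is a projector $P\notin\{0,I\}$ on $\mathbb C^n$ with $L_P\,G\,L_{I-P}=0$, where $L_P(x)=Px$; otherwise it is connected. *)

(* Defs.v *)
From HB Require Import structures.
From mathcomp Require Import all_boot all_order all_algebra.
From mathcomp Require Import complex.
From mathcomp Require Import boolp reals trigo.

Set Implicit Arguments.
Unset Strict Implicit.
Unset Printing Implicit Defensive.

Import GRing.Theory.

Local Open Scope ring_scope.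
Local Open Scope sesquilinear_scope.

Section QuantumGraphs.
Variables (R : realType) (n : nat).

Local Notation C := R[i].
Local Notation M := 'M[C]_n.
Local Notation E i j := (delta_mx i j : M).

Implicit Types (G : {linear M -> M}) (P : M).

Definition quantum_graph G : Prop :=
  (forall i j : 'I_n, \sum_k G (E i k) *m G (E k j) = G (E i j)) /\
  (forall x : M, G (x ^t*) = (G x) ^t*).

Definition undirected G : Prop :=
  forall x y : M, \tr (x ^t* *m G y) = \tr ((G x) ^t* *m y).

Definition loopless G : Prop :=
  forall i j : 'I_n, \sum_k G (E i k) *m E k j = 0.

Definition simple_quantum_graph G : Prop :=
  [/\ quantum_graph G, undirected G & loopless G].

Definition projector P : Prop := P *m P = P /\ P ^t* = P.

Definition disconnected G : Prop :=
  exists P, [/\ projector P, P <> 0, P <> 1%:M &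
    mulmx P \o G \o mulmx (1%:M - P) =1 (fun=> 0)].

Definition connected G : Prop := ~ disconnected G.

Section Diagonal.
Variables A B D : M.

(* D is the third coefficient matrix, usually written C *)
Definition XABC (x : M) : M :=
  \sum_i \sum_(j | i != j) (A i j * x j j) *: E i i
  + \sum_i \sum_j (B i j * x i j) *: E i j
  + \sum_i \sum_(j | i != j) (D i j * x j i) *: E i j.

Lemma XABC_linear : linear XABC.
Proof.
move=> a x y; rewrite /XABC !scalerDr.
rewrite [RHS]addrACA [X in _ = X + _]addrACA; congr (_ + _ + _);
  rewrite scaler_sumr -big_split; apply: eq_bigr => i _ /=;
  rewrite scaler_sumr -big_split; apply: eq_bigr => j _ /=;
  by rewrite !mxE mulrDr scalerDl scalerA mulrCA.
Qed.

HB.instance Definition _ :=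
  GRing.isLinear.Build C M M *:%R XABC XABC_linear.

End Diagonal.

Definition edge_block (A D : M) (i j : 'I_n) : 'M[C]_(1 + 1) :=
  block_mx (A i j)%:M (D i j)%:M (D j i)%:M (A j i)%:M.

Definition expi (t : R) : C := Complex (cos t) (sin t).

Definition strange_block (t : R) : 'M[C]_(1 + 1) :=
  2^-1 *: block_mx 1%:M (expi t)%:M (expi (- t))%:M 1%:M.

(* Only the pairs i < j carry edge data, so that the phase is unambiguous. *)
Record strange_graph_type := StrangeGraph {
  classical_edge : 'I_n -> 'I_n -> Prop;
  strange_edge : R -> 'I_n -> 'I_n -> Prop
}.

Definition strange_graph (A D : M) : strange_graph_type := {|
  classical_edge i j := (i < j)%N /\ edge_block A D i j = 1%:M;
  strange_edge t i j :=
    [/\ (i < j)%N, 0 <= t, t < 2 * pi & edge_block A D i j = strange_block t]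
|}.

Definition oriented_edge (S : strange_graph_type) (i j : 'I_n) : Prop :=
  classical_edge S i j \/ exists t, strange_edge S t i j.

Definition adjacent (S : strange_graph_type) : rel 'I_n :=
  fun i j => `[< oriented_edge S i j \/ oriented_edge S j i >].

Definition strange_connected (S : strange_graph_type) : Prop :=
  forall i j : 'I_n, connect (adjacent S) i j.

End QuantumGraphs.

(* Main.v *)
Require Import Defs.
From mathcomp Require Import all_boot all_order all_algebra.
From mathcomp Require Import complex.
From mathcomp Require Import reals.
From mathcomp Require Import boolp trigo ring lra.

Set Implicit Arguments.
Unset Strict Implicit.

Import Order.TTheory GRing.Theory Num.Theory.

Local Open Scope ring_scope.
Local Open Scope sesquilinear_scope.

(** The entries of [L_P G L_(1-P)] on matrix units give, for [s != l], the
    relation [A s l * p_s q_l + C l s * p_l q_s = 0], where [p_s] is the [s]-th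
    column of [P] and [q_l] the [l]-th row of [Q = 1 - P]. Since [P s s + Q s s
    = 1], [p_s] and [q_s] never both vanish. Across an edge ([A s l != 0]), the
    relation propagates [p_s = 0], propagates [q_s = 0], and otherwise forces
    [p_l] to be proportional to [p_s] and [q_l] to [q_s]. If the strange graph
    is connected then [P = 0], or [Q = 0], or [P] and [Q] both have rank at
    most one, and then [n <= 2]. Conversely, the diagonal projector onto a
    connected component disconnects the quantum graph. *)

(** * Propagation along edges and a rank bound *)

Lemma connect_invariant (T : finType) (e : rel T) (I : T -> Prop) (x y : T) :
  (forall u v, e u v -> I u -> I v) -> connect e x y -> I x -> I y.
Proof.
move=> eI /connectP[p + ->]; elim: p x => [//|z p IHp] x /= /andP[xz zp] Ix.
exact: IHp zp (eI _ _ xz Ix).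
Qed.

Lemma split_identity_trivial (F : fieldType) (n : nat) (e : rel 'I_n)
    (A D P Q : 'M[F]_n) :
  (2 < n)%N -> P + Q = 1%:M -> symmetric e ->
  (forall s l, e s l -> A s l != 0) ->
  (forall s l r k, e s l ->
     P r s * A s l * Q l k + P r l * D l s * Q s k = 0) ->
  (forall s l, connect e s l) ->
  P = 0 \/ Q = 0.
Proof.
move=> n_gt2 PQ1 e_sym A_neq0 rel0 conn.
have PQss s : P s s + Q s s = 1.
  by have /matrixP/(_ s s) := PQ1; rewrite !mxE eqxx.
case: (pselect (exists s, forall r, P r s = 0)) => [[s ps0]|p_neq0].
  left; apply/matrixP => r l; rewrite mxE.
  suff /(_ l): forall l, forall r, P r l = 0 by apply.
  move=> {r}l; apply: (@connect_invariant _ e (fun l => forall r, P r l = 0))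
    (conn s l) ps0 => u v uv pu0 r.
  have Quu : Q u u = 1 by rewrite -(PQss u) pu0 add0r.
  have vu : e v u by rewrite e_sym.
  (* On the reversed edge with [k = u], the second term carries [P r u = 0] and [Q u u] is [1],
     which leaves [P r v * A v u = 0]. *)
  have := rel0 v u r u vu; rewrite pu0 !mul0r addr0 Quu mulr1.
  by move/eqP; rewrite mulf_eq0 (negbTE (A_neq0 _ _ vu)) orbF => /eqP.
case: (pselect (exists s, forall k, Q s k = 0)) => [[s qs0]|q_neq0].
  right; apply/matrixP => l k; rewrite mxE.
  suff /(_ l): forall l, forall k, Q l k = 0 by apply.
  move=> {k}l; apply: (@connect_invariant _ e (fun l => forall k, Q l k = 0))
    (conn s l) qs0 => u v uv qu0 k.
  have Puu : P u u = 1 by rewrite -(PQss u) qu0 addr0.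
  have := rel0 u v u k uv; rewrite qu0 mulr0 addr0 Puu mul1r.
  by move/eqP; rewrite mulf_eq0 (negbTE (A_neq0 _ _ uv)) => /eqP.
have Pn0 s : exists r, P r s != 0.
  apply: contra_notP p_neq0 => Hs; exists s => r.
  by apply/eqP; apply: contra_notT Hs => Prs; exists r.
have Qn0 s : exists k, Q s k != 0.
  apply: contra_notP q_neq0 => Hs; exists s => k.
  by apply/eqP; apply: contra_notT Hs => Qsk; exists k.
have s0 : 'I_n := Ordinal (ltn_trans (isT : 0 < 2)%N n_gt2).
have row_leP l : (row l P^T <= row s0 P^T)%MS.
  apply: (@connect_invariant _ e (fun l => (row l P^T <= row s0 P^T)%MS))
    (conn s0 l) (submx_refl _) => u v uv; apply: submx_trans.
  have [k Quk] := Qn0 u.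
  have vu : e v u by rewrite e_sym.
  have Avu := A_neq0 _ _ vu.
  (* Dividing the relation on [(v, u)] by [A v u * Q u k] expresses [P r v] through [P r u]; the
     factor does not depend on [r], so whole columns of [P] are proportional. *)
  apply/sub_rVP; exists (- (D u v * Q v k) / (A v u * Q u k)).
  apply/rowP => r; rewrite !mxE.
  have nz : A v u * Q u k != 0 by rewrite mulf_neq0.
  apply: (mulIf nz); rewrite mulrAC divfK //.
  by apply/eqP; rewrite -subr_eq0 -(rel0 v u r k vu); apply/eqP; ring.
have row_leQ l : (row l Q <= row s0 Q)%MS.
  apply: (@connect_invariant _ e (fun l => (row l Q <= row s0 Q)%MS))
    (conn s0 l) (submx_refl _) => u v uv; apply: submx_trans.
  have [r Pru] := Pn0 u.
  have Auv := A_neq0 _ _ uv.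
  (* Here the pivot is a nonzero entry of column [u] of [P], and the factor is independent of
     [k]. *)
  apply/sub_rVP; exists (- (P r v * D v u) / (P r u * A u v)).
  apply/rowP => k; rewrite !mxE.
  have nz : P r u * A u v != 0 by rewrite mulf_neq0.
  apply: (mulIf nz); rewrite mulrAC divfK //.
  by apply/eqP; rewrite -subr_eq0 -(rel0 u v r k uv); apply/eqP; ring.
have rkP : (\rank P <= 1)%N.
  rewrite -mxrank_tr; apply: leq_trans (rank_leq_row (row s0 P^T)).
  by apply: mxrankS; apply/row_subP.
have rkQ : (\rank Q <= 1)%N.
  apply: leq_trans (rank_leq_row (row s0 Q)).
  by apply: mxrankS; apply/row_subP.
have := mxrank_add P Q; rewrite PQ1 mxrank1 => n_le.
by have := leq_trans n_le (leq_add rkP rkQ); rewrite leqNgt n_gt2.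
Qed.

(** * Coefficient identities extracted from the quantum graph axioms *)

Section Coefficients.
Variables (R : realType) (n : nat) (A B D : 'M[R[i]]_n).

Lemma XABC_E (x : 'M[R[i]]_n) (r c : 'I_n) :
  XABC A B D x r c =
    (r == c)%:R * (\sum_(j | r != j) A r j * x j j) + B r c * x r c
    + (r != c)%:R * (D r c * x c r).
Proof.
rewrite /XABC !mxE !summxE; congr (_ + _ + _).
- rewrite (bigD1 r) //= summxE [X in _ + X]big1 ?addr0 => [|i /negbTE ir].
    rewrite mulr_sumr; apply: eq_bigr => j _.
    by rewrite !mxE eqxx /= eq_sym mulrC.
  rewrite summxE big1 // => j _; rewrite !mxE [r == i]eq_sym ir /= mulr0.
  by [].
- rewrite (bigD1 r) //= summxE [X in _ + X]big1 ?addr0 => [|i /negbTE ir].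
    rewrite (bigD1 c) //= big1 ?addr0 => [|j /negbTE jc].
      by rewrite !mxE !eqxx mulr1.
    by rewrite !mxE [c == j]eq_sym jc andbF mulr0.
  by rewrite summxE big1 // => j _; rewrite !mxE [r == i]eq_sym ir /= mulr0.
- rewrite (bigD1 r) //= summxE [X in _ + X]big1 ?addr0 => [|i /negbTE ir].
    have [<-|rc] /= := eqVneq r c.
      rewrite mul0r big1 // => j /negbTE rj.
      by rewrite !mxE rj andbF mulr0.
    rewrite (bigD1 c) //= big1 ?addr0 => [|j /andP[_ /negbTE jc]].
      by rewrite !mxE !eqxx mulr1 mul1r.
    by rewrite !mxE [c == j]eq_sym jc andbF mulr0.
  by rewrite summxE big1 // => j _; rewrite !mxE [r == i]eq_sym ir /= mulr0.
Qed.

Hypothesis AB : forall i, A i i = B i i.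

(** The [A]-sum omits position [(k, k)]; the [B]-sum supplies it, since the two diagonals agree. *)
Lemma XABC_delta_diag (k : 'I_n) :
  XABC A B D (delta_mx k k) = diag_mx (row k A^T).
Proof.
apply/matrixP => r c; rewrite XABC_E !mxE.
have -> : \sum_(j | r != j) A r j * delta_mx k k j j = A r k *+ (r != k).
  have [<-|rk] := eqVneq r k.
    by rewrite big1 // => j /negbTE rj; rewrite !mxE eq_sym rj mulr0.
  rewrite (bigD1 k) //= big1 ?addr0 => [|j /andP[_ /negbTE jk]].
    by rewrite !mxE eqxx mulr1.
  by rewrite !mxE jk mulr0.
have [<-{c}|rc] /= := eqVneq r c.
  rewrite mul0r addr0 mul1r; have [<-|rk] /= := eqVneq r k.
    by rewrite add0r mulr1 AB.
  by rewrite mulr0 addr0.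
rewrite mul0r add0r mul1r; have [rk|rk] /= := eqVneq r k.
  by rewrite -rk [c == r]eq_sym (negbTE rc) /= !mulr0 addr0.
by rewrite andbF !mulr0 addr0.
Qed.

Lemma XABC_delta (k l : 'I_n) : k != l ->
  XABC A B D (delta_mx k l) = B k l *: delta_mx k l + D l k *: delta_mx l k.
Proof.
move=> kl; apply/matrixP => r c; rewrite XABC_E !mxE big1 => [|j _]; last first.
  rewrite mxE; case: (eqVneq j k) => [->|_] /=; last by rewrite mulr0.
  by rewrite (negbTE kl) mulr0.
rewrite mulr0 add0r; congr (_ + _).
  by case: eqP => [->|_]; case: eqP => [->|_]; rewrite /= ?mulr0.
rewrite [(c == k) && _]andbC.
case: (eqVneq r l) => [->|_]; case: (eqVneq c k) => [->|_];
  by rewrite /= ?mulr0 // [l == k]eq_sym kl mul1r.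
Qed.

(** The image of [delta_mx i k] is diagonal for [k = i] and otherwise supported at [(i, k)] and
    [(k, i)], so a row [j != i] meets it only for [k = i] or [k = j]. *)
Lemma row_XABC_delta_mul (i j k : 'I_n) (Y : 'M[R[i]]_n) : j != i ->
  row j (XABC A B D (delta_mx i k) *m Y) =
    (A j i *+ (k == i)) *: row j Y + (D j i *+ (k == j)) *: row i Y.
Proof.
move=> ji; rewrite row_mul; have [->|ki] := eqVneq k i.
  rewrite [i == j]eq_sym (negbTE ji) scale0r addr0 XABC_delta_diag.
  rewrite row_diag_mx -scalemxAl -rowE; congr (_ *: _).
  by rewrite !mxE.
rewrite scale0r add0r XABC_delta 1?eq_sym // linearD !linearZ /=.
rewrite !rowE !mul_delta_mx_cond (negbTE ji) mulr0n scaler0 add0r.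
rewrite -scalemxAl [j == k]eq_sym.
have [->|kj] := eqVneq k j; first by rewrite !mulr1n.
by rewrite !mulr0n mul0mx scaler0 scale0r.
Qed.

(** When [Y k] is the image of a matrix unit, this cuts the left side of the idempotency axiom down
    to two terms. *)
Lemma row_sum_XABC (i j : 'I_n) (Y : 'I_n -> 'M[R[i]]_n) : j != i ->
  row j (\sum_k XABC A B D (delta_mx i k) *m Y k) =
    A j i *: row j (Y i) + D j i *: row i (Y j).
Proof.
move=> ji; rewrite linear_sum /= (bigD1 i) //= (bigD1 j) //= big1 ?addr0.
  rewrite !row_XABC_delta_mul // !eqxx [i == j]eq_sym (negbTE ji).
  by rewrite !mulr0n !scale0r addr0 add0r.
move=> k /andP[/negbTE ki /negbTE kj].
by rewrite row_XABC_delta_mul // ki kj !scale0r addr0.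
Qed.

Hypothesis simpleX : simple_quantum_graph (XABC A B D).

(** The upper left entry of the statement that the edge block is idempotent, found at entry [(i, i)]
    of the axiom for [E j j]. *)
Lemma simple_idem (i j : 'I_n) : i != j ->
  A i j ^+ 2 + D i j * D j i = A i j.
Proof.
move=> ij; case: simpleX => [[schur _] _ _].
have := congr1 (row i) (schur j j); rewrite row_sum_XABC //.
move/matrixP/(_ 0 i); rewrite /= XABC_delta_diag XABC_delta // !mxE !eqxx.
by rewrite mulr1n [j == i]eq_sym (negbTE ij) /= mulr0 add0r mulr1 expr2.
Qed.

(** The upper right entry of the same block identity, found at entry [(i, j)] of the axiom for
    [E j i]. *)
Lemma simple_absorb (i j : 'I_n) : i != j ->
  (A i j + A j i) * D i j = D i j.
Proof.
move=> ij; case: simpleX => [[schur _] _ _].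
have := congr1 (row i) (schur j i); rewrite row_sum_XABC //.
have ji : j != i by rewrite eq_sym.
move/matrixP/(_ 0 j); rewrite /= XABC_delta_diag XABC_delta // !mxE !eqxx.
rewrite mulr1n (negbTE ij) /= mulr0 add0r mulr1 => absorb.
by rewrite -[RHS]absorb; ring.
Qed.

Lemma simple_D_conj (i j : 'I_n) : i != j -> D j i = (D i j)^*.
Proof.
move=> ij; case: simpleX => [[_ herm] _ _].
have := herm (delta_mx j i) => /matrixP/(_ j i).
have -> : (delta_mx j i ^t* : 'M[R[i]]_n) = delta_mx i j.
  by apply/matrixP => r c; rewrite !mxE andbC rmorph_nat.
rewrite /= !XABC_delta // 1?eq_sym // !mxE !eqxx (negbTE ij) eq_sym (negbTE ij).
by rewrite /= !mulr0 !mulr1 !add0r.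
Qed.

Lemma simple_A_real (i j : 'I_n) : (A i j)^* = A i j.
Proof.
case: simpleX => [[_ herm] _ _].
have := herm (delta_mx j j) => /matrixP/(_ i i).
have -> : (delta_mx j j ^t* : 'M[R[i]]_n) = delta_mx j j.
  by apply/matrixP => r c; rewrite !mxE andbC rmorph_nat.
by rewrite /= XABC_delta_diag !mxE eqxx mulr1n.
Qed.

(** Self-adjointness tested on two diagonal matrix units compares [A i j] with the conjugate of
    [A j i], and [A] is real. *)
Lemma simple_A_sym (i j : 'I_n) : A i j = A j i.
Proof.
case: simpleX => [_ undir _].
have conj_delta k : (delta_mx k k ^t* : 'M[R[i]]_n) = delta_mx k k.
  by apply/matrixP => r c; rewrite !mxE andbC rmorph_nat.
have conj_diag k : (diag_mx (row k A^T)) ^t* = diag_mx (row k A^T).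
  apply/matrixP => r c; rewrite !mxE eq_sym.
  have [->|_] := eqVneq r c; last by rewrite !mulr0n conjC0.
  by rewrite !mulr1n; exact: simple_A_real.
have tr_delta k (d : 'rV[R[i]]_n) : \tr (delta_mx k k *m diag_mx d) = d 0 k.
  rewrite mul_mx_diag /mxtrace (bigD1 k) //= big1 ?addr0 => [|r /negbTE rk].
    by rewrite !mxE !eqxx mul1r.
  by rewrite !mxE rk mul0r.
have := undir (delta_mx i i) (delta_mx j j).
rewrite /= !XABC_delta_diag conj_delta conj_diag tr_delta.
by rewrite mxtrace_mulC tr_delta !mxE.
Qed.

End Coefficients.

(** * Phases of unit complex numbers *)

Section Phase.
Variable R : realType.

Lemma polar_unit (a b : R) : a ^+ 2 + b ^+ 2 = 1 ->
  exists t, [/\ 0 <= t, t < 2 * pi, cos t = a & sin t = b].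
Proof.
move=> ab1.
have a_itv : -1 <= a <= 1.
  by rewrite -ler_norml -(ler_pXn2r (n := 2)) ?nnegrE // expr1n real_normK
    ?num_real // -ab1 lerDl sqr_ge0.
have pi_gt0 := pi_gt0 R.
have sqrtE : Num.sqrt (1 - a ^+ 2) = `|b|.
  by rewrite -ab1 addrAC subrr add0r sqrtr_sqr.
have [b_ge0|b_lt0] := leP 0 b.
  (* [acos] lands in [[0, pi]], where the sine is nonnegative; for negative [b] the angle is
     reflected to [2 * pi - acos a]. *)
  exists (acos a); split; first exact: acos_ge0.
  - by apply: le_lt_trans (acos_lepi a_itv) _; lra.
  - by rewrite acosK // in_itv.
  - by rewrite sin_acos // sqrtE ger0_norm.
(* Strictness makes [acos a] positive, which keeps the reflected angle below [2 * pi]. *)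
have a_lt1 : -1 <= a < 1.
  have [/andP[-> a_le1] b2_gt0] : -1 <= a <= 1 /\ 0 < b ^+ 2.
    by rewrite exprn_even_gt0 //= lt_eqF.
  rewrite /= lt_neqAle a_le1 andbT; apply/eqP => a1.
  by move: ab1; rewrite a1 expr1n; lra.
exists (2 * pi - acos a); split.
- by have := acos_lepi a_itv; lra.
- by have := acos_gt0 a_lt1; lra.
- by rewrite mulr_natl addrC cosD2pi cosN acosK ?in_itv.
- by rewrite mulr_natl addrC sinD2pi sinN sin_acos // sqrtE ltr0_norm ?opprK.
Qed.

Lemma phase_exists (w : R[i]) : w * w^* = 1 ->
  exists t, [/\ 0 <= t, t < 2 * pi & w = expi t].
Proof.
case: w => a b; have -> : (Complex a b)^* = Complex a (- b) by [].
move=> /(congr1 (@complex.Re R)) /= ab1.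
have [|t [t0 t2 ct st]] := @polar_unit a b.
  by rewrite -ab1; ring.
by exists t; split; rewrite // /expi ct st.
Qed.

Lemma expiN (t : R) : expi (- t) = (expi t)^*.
Proof. by rewrite /expi cosN sinN. Qed.

End Phase.

(** * Edges of the strange graph and disconnecting projectors *)

Section StrangeGraph.
Variables (R : realType) (n : nat) (A B D : 'M[R[i]]_n).
Hypothesis AB : forall i, A i i = B i i.
Hypothesis simpleX : simple_quantum_graph (XABC A B D).

(** The upper left entry of the block is [1] on a classical edge and [1/2] on a strange one. *)
Lemma oriented_edge_neq0 (i j : 'I_n) :
  oriented_edge (strange_graph A D) i j -> i != j /\ A i j != 0.
Proof.
case=> [[ij]|[t [ij _ _]]] eq_blk; split; try by rewrite neq_ltn ij.
  move: eq_blk; rewrite /edge_block (scalar_mx_block 1 1 1).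
  move/eq_block_mx => [+ _ _ _].
  by move/matrixP/(_ 0 0); rewrite !mxE /= !mulr1n => ->; rewrite oner_eq0.
move: eq_blk; rewrite /edge_block /strange_block scale_block_mx.
move/eq_block_mx => [+ _ _ _].
move/matrixP/(_ 0 0); rewrite !mxE /= !mulr1n mulr1 => ->.
by rewrite invr_eq0 pnatr_eq0.
Qed.

(** If [D i j = 0], idempotency forces [A i j = 1] and the block is the identity. Otherwise
    absorption and symmetry force [A i j = 1/2], and idempotency then gives [2 * D i j] modulus one,
    hence a phase. *)
Lemma oriented_edge_of_neq0 (i j : 'I_n) :
  (i < j)%N -> A i j != 0 -> oriented_edge (strange_graph A D) i j.
Proof.
move=> lt_ij A0; have ij : i != j by rewrite neq_ltn lt_ij.
have idem := simple_idem AB simpleX ij.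
have absorb := simple_absorb AB simpleX ij.
have conjD := simple_D_conj simpleX ij.
have symA := simple_A_sym AB simpleX j i.
have [D0|D0] := eqVneq (D i j) 0.
  have A1 : A i j = 1.
    by apply: (mulfI A0); rewrite mulr1 -expr2 -[RHS]idem D0 mul0r addr0.
  left; split=> //; rewrite /edge_block symA conjD D0 conjC0 A1.
  by rewrite (scalar_mx_block 1 1 1) raddf0.
have A2 : A i j + A i j = 1.
  by apply: (mulIf D0); rewrite mul1r -[RHS]absorb symA.
have Ah : A i j = 2^-1.
  have two0 : 2 != 0 :> R[i] by rewrite pnatr_eq0.
  by apply: (mulfI two0); rewrite mulfV // mulr_natl mulr2n.
right; have [|t [t0 t2 Dt]] := @phase_exists R (2 * D i j).
  rewrite rmorphM rmorph_nat /= -conjD; move: idem; rewrite Ah => idem.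
  (* Arranged so that the left side of [idem] appears; its value [1/2] turns the whole into
     [4/2 - 1 = 1]. *)
  have -> : 2 * D i j * (2 * D j i) =
      4 * (2^-1 ^+ 2 + D i j * D j i) - (2 * 2^-1) ^+ 2 by ring.
  by rewrite idem; field.
exists t; split=> //; rewrite /edge_block /strange_block scale_block_mx.
have Dij : D i j = 2^-1 * expi t by rewrite -Dt mulKf // pnatr_eq0.
have Dji : D j i = 2^-1 * (expi t)^*.
  by rewrite conjD Dij rmorphM /= fmorphV rmorph_nat.
by rewrite !scale_scalar_mx expiN symA Ah mulr1 Dij Dji.
Qed.

(** This removes edge types and phases from the connectivity question: only the zero pattern of [A]
    remains. *)
Lemma adjacent_strange_graph (i j : 'I_n) :
  adjacent (strange_graph A D) i j = (i != j) && (A i j != 0).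
Proof.
apply/idP/idP => [/asboolP[/oriented_edge_neq0[-> ->] //|]|/andP[ij A0]].
  move/oriented_edge_neq0; rewrite eq_sym (simple_A_sym AB simpleX j i).
  by case=> -> ->.
apply/asboolP; case: (ltngtP i j) => [lt_ij|lt_ji|/val_inj eq_ij].
- by left; apply: oriented_edge_of_neq0.
- by right; apply: oriented_edge_of_neq0 => //;
  rewrite (simple_A_sym AB simpleX).
- by rewrite eq_ij eqxx in ij.
Qed.

(** [Q *m delta_mx k l] lives in column [l]. Column [s] of its image thus has no [B] contribution
    and two possible entries: row [s] through [A] and row [l] through [D]. *)
Lemma disconnecting_relation (P Q : 'M[R[i]]_n) (r k s l : 'I_n) :
  mulmx P \o XABC A B D \o mulmx Q =1 (fun=> 0) -> s != l ->
  P r s * A s l * Q l k + P r l * D l s * Q s k = 0.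
Proof.
move=> PGQ0 sl.
have := PGQ0 (delta_mx k l) => /matrixP/(_ r s) /=; rewrite !mxE.
have QE a b : (Q *m delta_mx k l) a b = Q a k *+ (b == l).
  rewrite mxE (bigD1 k) //= big1 ?addr0 => [|j /negbTE jk].
    by rewrite mxE eqxx; case: (b == l); rewrite ?mulr1 ?mulr0.
  by rewrite mxE jk mulr0.
move=> <-; rewrite (bigD1 s) //= (bigD1 l) 1?eq_sym //= big1 ?addr0.
  rewrite !XABC_E !QE !eqxx (negbTE sl) [l == s]eq_sym (negbTE sl) /=.
  rewrite (bigD1 l) //= big1 ?addr0 => [|j /andP[_ /negbTE jl]].
    by rewrite QE eqxx !mulr0 !mul0r !mulr1n !add0r !addr0 !mul1r !mulrA.
  by rewrite QE jl mulr0.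
move=> m /andP[/negbTE ms /negbTE ml].
by rewrite XABC_E !QE ms ml (negbTE sl) /= !mulr0n !mulr0 mul0r !addr0 mulr0.
Qed.

Lemma disconnected_of_closed (S : pred 'I_n) (i j : 'I_n) :
  S i -> ~~ S j ->
  (forall s l, S s -> ~~ S l -> A s l = 0 /\ D s l = 0) ->
  disconnected (XABC A B D).
Proof.
move=> Si Sj closedS.
pose P : 'M[R[i]]_n := diag_mx (\row_k (S k)%:R).
have PE r c : P r c = (S r)%:R *+ (r == c).
  by rewrite !mxE; case: eqP => [->|].
exists P; split.
- split; first rewrite mulmx_diag; apply/matrixP => r c.
    by rewrite !mxE -natrM mulnb andbb.
  by rewrite 2!mxE !PE rmorphMn rmorph_nat eq_sym; case: eqP => [->|].
- by move/matrixP/(_ i i)/eqP; rewrite PE Si mxE eqxx oner_eq0.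
- by move/matrixP/(_ j j)/esym/eqP; rewrite PE (negbTE Sj) mxE eqxx oner_eq0.
move=> x; apply/matrixP => r c /=.
(* The rows of [y] indexed by [S] vanish. For [r] in [S], every term in row [r] of the image of [y]
   therefore has either a zero entry of [y] or a coefficient linking [S] to its complement, which is
   zero. *)
set y := (_ - _) *m x.
have y0 a b : S a -> y a b = 0.
  move=> Sa; rewrite mxE big1 // => k _.
  rewrite 2!mxE [X in _ + X]mxE PE Sa.
  by rewrite subrr mul0r.
rewrite mul_diag_mx [LHS]mxE [X in X * _]mxE [RHS]mxE.
have [Sr|_] := boolP (S r); last by rewrite mul0r.
rewrite mul1r XABC_E [y r c]y0 // mulr0 addr0.
rewrite big1 ?mulr0 ?add0r => [|k _]; last first.
  have [Sk|Sk] := boolP (S k); first by rewrite y0 ?mulr0.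
  by have [-> _] := closedS _ _ Sr Sk; rewrite mul0r.
have [Sc|Sc] := boolP (S c); first by rewrite y0 ?mulr0.
by have [_ ->] := closedS _ _ Sr Sc; rewrite mul0r mulr0.
Qed.

End StrangeGraph.

Theorem proposition4p15 (R : realType) (n : nat) (A B C : 'M[R[i]]_n) :
  (3 <= n)%N ->
  (forall i : 'I_n, A i i = B i i) ->
  (forall i : 'I_n, B i i = C i i) ->
  simple_quantum_graph (XABC A B C) ->
  (connected (XABC A B C) <-> strange_connected (strange_graph A C)).
Proof.
move=> n_ge3 AB _ simpleX; have adjE := adjacent_strange_graph AB simpleX.
split=> [connX i j|conn [P [_ P0 P1 PGQ0]]].
  apply: contra_notT connX => Nij.
  apply: (@disconnected_of_closed _ _ _ _ _
    (connect (adjacent (strange_graph A C)) i) i j) => //.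
  move=> s l is_ Nil.
  have sl : s != l by apply: contraNneq Nil => <-.
  have A0 : A s l = 0.
    apply/eqP; apply: contraNT Nil => A0; apply: connect_trans is_ _.
    by apply: connect1; rewrite adjE sl A0.
  (* [C s l] vanishes as well: absorption makes it a multiple of [A s l + A l s]. *)
  split=> //; rewrite -(simple_absorb AB simpleX sl).
  by rewrite (simple_A_sym AB simpleX l s) A0 addr0 mul0r.
(* With [1 - P] as second matrix, the two outcomes are [P = 0] and [P = 1], both excluded. *)
have [|||||/eqP] := @split_identity_trivial _ _ (adjacent (strange_graph A C))
  A C P (1%:M - P) n_ge3 _ _ _ _ conn => //.
- by rewrite addrC subrK.
- by move=> i j; rewrite !adjE eq_sym (simple_A_sym AB simpleX).
- by move=> s l; rewrite adjE => /andP[].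
- move=> s l r k; rewrite adjE => /andP[sl _].
  exact: disconnecting_relation PGQ0 sl.
- by rewrite subr_eq0 => /eqP/esym.
Qed.
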